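(* Let $\chi$ be a bicharacter on $\mathbb Z^n$ and $E$ a basis of $\mathbb Z^n$. Then the Weyl groupoid $W_{\chi,E}$ is finite if and only if the graph $\mathfrak D^{\chi,E}$ and the group $\mathcal G_{\chi,E}$ are finite.
   Context: $k$ is a field of characteristic $0$, $k^\ast=k\setminus\{0\}$, $\mathbb N_0=\{0,1,2,\dots\}$. A bicharacter on $\mathbb Z^n$ is a map $\chi:\mathbb Z^n\times\mathbb Z^n\to k^\ast$ with $\chi(0,a)=\chi(a,0)=1$, $\chi(a+b,c)=\chi(a,c)\chi(b,c)$, $\chi(a,b+c)=\chi(a,b)\chi(a,c)$. Let $F$ be a basis of $\mathbb Z^n$ and $f\in F$. For $f'\in F\setminus\{f\}$ put $$m(f,f')=\min\{m\in\mathbb N_0 \mid \chi(f,f)^m\chi(f,f')\chi(f',f)=1\ \text{or}\ (\chi(f,f)^{m+1}=1,\ \chi(f,f)\ne1)\}$$ if this minimum exists, and $m(f,f)=-2$. If all $m(f,f')$ exist, the reflection $s_{f,F}\in\mathrm{Aut}(\mathbb Z^n)$ (with respect to $\chi$) is defined as the linear map with $s_{f,F}(f')=f'+m(f,f')f$ for all $f'\in F$; otherwise $s_{f,F}$ is not defined. Let $\widetilde W$ be the groupoid of all pairs $(T,F)$, $T\in\mathrm{Aut}(\mathbb Z^n)$, $F$ a basis of $\mathbb Z^n$, where $(T_1,F_1)\circ(T_2,F_2)$ is defined, and equals $(T_1T_2,F_2)$, iff $T_2(F_2)=F_1$. The Weyl groupoid $W_{\chi,E}$ is the smallest subgroupoid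 of $\widetilde W$ containing $(\mathrm{id},E)$ and such that if $(\mathrm{id},F)\in W_{\chi,E}$, $f\in F$ and $s_{f,F}$ is defined, then $(s_{f,F},F),(\mathrm{id},s_{f,F}(F))\in W_{\chi,E}$. Put $W^{\mathrm{ext}}_{\chi,E}=\{(\tau T,F)\mid (T,F)\in W_{\chi,E},\ \tau\in\mathrm{Aut}(\mathbb Z^n),\ \tau T(F)=T(F)\}$. Pairs $(\chi,E)$, $(\chi',E)$ are Weyl equivalent if there is $T\in\mathrm{Aut}(\mathbb Z^n)$ with $(T,E)\in W^{\mathrm{ext}}_{\chi',E}$ and $\chi(e,e)=\chi'(T(e),T(e))$ for all $e\in\mathbb Z^n$. For a basis $F=\{f_1,\dots,f_n\}$ the generalized Dynkin diagram $\mathcal D_{\chi,F}$ is the undirected graph with $n$ vertices, the $i$-th labelled $\chi(f_i,f_i)$, with no edge between vertices $i\ne j$ if $\chi(f_i,f_j)\chi(f_j,f_i)=1$ and one edge labelled $\chi(f_i,f_j)\chi(f_j,f_i)$ otherwise. The oriented graph $\mathfrak D^{\chi,E}$ has as vertices all generalized Dynkin diagrams $\mathcal D$ of the form $\mathcal D=\mathcal D_{\chi',E}$ with $(\chi',E)$ Weyl equivalent to $(\chi,E)$. For each such $\mathcal D=\mathcal D_{\chi',E}$ and each $e\in E$ such that $s_{e,E}$ (with respect to $\chi'$) is defined, there is an arrow from $\mathcal D$ to $\mathcal D_{\chi',s_{e,E}(E)}$, labelled by the vertex of $\mathcal D$ corresponding to $e$. $\mathcal G_{\chi,E}=\{T\in\mathrm{Aut}(\mathbb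 Z^n)\mid (T,E)\in W^{\mathrm{ext}}_{\chi,E},\ \chi(T(e),T(e))=\chi(e,e)\text{ for all }e\in\mathbb Z^n\}$, which is a subgroup of $\mathrm{Aut}(\mathbb Z^n)$. *)

(* Defs.v *)
From mathcomp Require Import all_boot all_order all_algebra.
From mathcomp Require Import finmap.
From mathcomp Require Import boolp classical_sets functions cardinality.

Set Implicit Arguments.
Unset Strict Implicit.
Unset Printing Implicit Defensive.

Import Order.TTheory GRing.Theory Num.Theory.
Local Open Scope classical_set_scope.
Local Open Scope ring_scope.

(* Z^n is 'cV[int]_n, and Aut(Z^n) is the group of integer matrices invertible
   over int (membership in unitmx), acting on columns by T *m v; so *m is
   composition. *)

Record bicharacter (k : fieldType) (n : nat) := Bicharacter {
  bichar_fun :> 'cV[int]_n -> 'cV[int]_n -> k;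
  bichar_neq0 : forall a b, bichar_fun a b != 0;
  bichar0l : forall a, bichar_fun 0 a = 1;
  bichar0r : forall a, bichar_fun a 0 = 1;
  bicharDl : forall a b c,
    bichar_fun (a + b) c = bichar_fun a c * bichar_fun b c;
  bicharDr : forall a b c,
    bichar_fun a (b + c) = bichar_fun a b * bichar_fun a c
}.

(* Bases are unordered. *)
Definition is_basis (n : nat) (F : {fset 'cV[int]_n}) : Prop :=
  forall v : 'cV[int]_n,
    exists! c : {ffun F -> int}, v = \sum_(f : F) c f *: val f.

Definition act (n : nat) (T : 'M[int]_n) (F : {fset 'cV[int]_n}) :
    {fset 'cV[int]_n} :=
  [fset T *m f | f in F]%fset.

Section WeylGroupoid.
Variables (k : fieldType) (n : nat).
Implicit Types (chi : bicharacter k n) (E F : {fset 'cV[int]_n}).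
Implicit Types (T s tau : 'M[int]_n).

Definition cartan_cond chi (f f' : 'cV[int]_n) (m : nat) : Prop :=
  chi f f ^+ m * chi f f' * chi f' f = 1
  \/ (chi f f ^+ m.+1 = 1 /\ chi f f <> 1).

(* The relation "m(f,f') exists and equals m". *)
Definition cartan_entry chi (f f' : 'cV[int]_n) (m : int) : Prop :=
  if f' == f then m = - 2%:Z
  else exists p : nat,
    [/\ m = p%:Z, cartan_cond chi f f' p
      & forall q : nat, cartan_cond chi f f' q -> (p <= q)%N].

(* The relation "s_{f,F} is defined (with respect to chi) and equals s"; a
   linear map is determined by its values on the basis F. *)
Definition reflection chi F (f : 'cV[int]_n) s : Prop :=
  f \in F /\
  forall f', f' \in F ->
    exists m : int, cartan_entry chi f f' m /\ s *m f' = f' + m *: f.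

(* The pair (T, F) is a morphism from F to act T F. *)
Definition full_groupoid : set ('M[int]_n * {fset 'cV[int]_n}) :=
  [set p | p.1 \in unitmx /\ is_basis p.2].

Definition subgroupoid (S : set ('M[int]_n * {fset 'cV[int]_n})) : Prop :=
  [/\ S `<=` full_groupoid,
      (forall T1 F1 T2 F2, S (T1, F1) -> S (T2, F2) -> act T2 F2 = F1 ->
         S (T1 *m T2, F2))
    & (forall T F, S (T, F) -> S (invmx T, act T F))].

Definition reflection_closed chi
    (S : set ('M[int]_n * {fset 'cV[int]_n})) : Prop :=
  forall F f s, S (1%:M, F) -> reflection chi F f s ->
    S (s, F) /\ S (1%:M, act s F).

Definition weyl_groupoid chi E : set ('M[int]_n * {fset 'cV[int]_n}) :=
  smallest (fun S => subgroupoid S /\ reflection_closed chi S)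
    [set (1%:M, E)].

Definition weyl_groupoid_ext chi E : set ('M[int]_n * {fset 'cV[int]_n}) :=
  [set p | exists T tau F,
     [/\ weyl_groupoid chi E (T, F), tau \in unitmx,
         act (tau *m T) F = act T F & p = (tau *m T, F)]].

(* Weyl equivalence of (chi, E) and (chi', E), in this order. *)
Definition weyl_equivalent chi chi' E : Prop :=
  exists T, [/\ T \in unitmx, weyl_groupoid_ext chi' E (T, E)
              & forall e, chi e e = chi' (T *m e) (T *m e)].

Definition weyl_aut_group chi E : set 'M[int]_n :=
  [set T | [/\ T \in unitmx, weyl_groupoid_ext chi E (T, E)
             & forall e, chi (T *m e) (T *m e) = chi e e]].

End WeylGroupoid.

(* Labelled graphs with vertex set I; elabel i j = None means that there is no
   edge between i and j. *)
Record diagram (k I : Type) := Diagram {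
  vlabel : I -> k;
  elabel : I -> I -> option k
}.

(* The generalized Dynkin diagram of a basis listed as a family b : I -> Z^n. *)
Definition dynkin (k : fieldType) (n : nat) (I : eqType)
    (chi : bicharacter k n) (b : I -> 'cV[int]_n) : diagram k I :=
  {| vlabel := fun i => chi (b i) (b i);
     elabel := fun i j =>
       if (i != j) && (chi (b i) (b j) * chi (b j) (b i) != 1)
       then Some (chi (b i) (b j) * chi (b j) (b i)) else None |}.

(* Oriented graphs with labelled arrows (source, label, target). *)
Record digraph (V L : Type) := Digraph {
  gvertices : set V;
  garrows : set (V * L * V)
}.

Definition finite_digraph (V L : Type) (G : digraph V L) : Prop :=
  finite_set (gvertices G) /\ finite_set (garrows G).

(* Diagrams are indexed by E itself.  D_{chi',E} is the diagram of the
   inclusion of E, and in D_{chi',s(E)} the vertex s(e) carries the index e,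
   i.e. a numbering e_1, ..., e_n of E numbers s(E) by s(e_1), ..., s(e_n). *)
Definition weyl_graph (k : fieldType) (n : nat) (chi : bicharacter k n)
    (E : {fset 'cV[int]_n}) : digraph (diagram k E) E :=
  {| gvertices := [set D | exists chi' : bicharacter k n,
       weyl_equivalent chi' chi E /\
       D = dynkin chi' (fun e : E => val e)];
     garrows := [set a | exists (chi' : bicharacter k n) (e : E) (s : 'M[int]_n),
       [/\ weyl_equivalent chi' chi E,
           reflection chi' E (val e) s
         & a = (dynkin chi' (fun e' : E => val e'), e,
                dynkin chi' (fun e' : E => s *m val e'))]] |}.

(* Main.v *)
Require Import Defs.
From mathcomp Require Import all_boot all_order all_algebra.
From mathcomp Require Import finmap.
From mathcomp Require Import boolp classical_sets functions cardinality.

(** Write W for the Weyl groupoid, R for the set of T such that (T, E) is in W,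
    and q(v) = chi(v, v). The groupoid is connected: every element of W is
    (T2 T1^-1, T1(E)) with T1, T2 in R (weyl_span), so W is finite if and only
    if R is. Everything else compares R with the diagrams of the bases T(E),
    through two facts.

    First, a diagram of a basis determines q in the coordinates of that basis
    (dynkin_norm), because q is a quadratic form with values in k^* whose
    polarization chi(x, y) chi(y, x) is bimultiplicative. Conversely q
    determines the numbers m(f, f'), hence the reflections. So the diagram of
    (chi', E) is that of T(E) for chi, where T is any witness of Weyl
    equivalence; and an arrow of the graph is determined by its source and its
    label.

    If W is finite, then so are the extended morphisms starting at E: such a
    morphism maps E onto one of the finitely many bases that occur in W, and
    two bases are related by finitely many linear maps. Their diagrams exhaust
    the vertices, the vertices and labels bound the arrows, and the group is a
    set of extended morphisms.

    If the graph and the group are finite, send T in R to the diagram of T(E),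
    a vertex. If T1 and T2 have the same image, T = T1 T2^-1 preserves q, so it
    remains to see that (T, E) is in W (weyl_isometry): the fibre of T2 is then
    contained in the coset G T2 of the finite group G. The definition of W
    singles out the base E, but all bases occurring in W generate the same
    groupoid (weyl_base), since the reflection of F at f is also the
    reflection of its image at -f (reflection_back). As T preserves q,
    conjugation by T maps the groupoid generated by T2(E) into the one
    generated by T1(E) (weyl_conj), and so W into itself. Therefore
    (T T2^-1 T^-1, T1(E)) is in W, and composing it with (T1, E) gives
    (T, E). *)

Set Implicit Arguments.
Unset Strict Implicit.
Unset Printing Implicit Defensive.

Import GRing.Theory.
Local Open Scope classical_set_scope.
Local Open Scope ring_scope.

(** * Integer matrices acting on bases *)

Section Bases.
Variable n : nat.
Implicit Types (F : {fset 'cV[int]_n}) (A B T : 'M[int]_n).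

Lemma mem_act T F f : f \in F -> T *m f \in act T F.
Proof. exact: in_imfset. Qed.

Lemma actP T F g : g \in act T F -> exists2 f, f \in F & g = T *m f.
Proof. by case/imfsetP=> f Ff ->; exists f. Qed.

Lemma act1 F : act 1%:M F = F.
Proof.
apply/fsetP=> g; apply/idP/idP => [/actP[f Ff ->]|Fg]; first by rewrite mul1mx.
by rewrite -(mul1mx g) mem_act.
Qed.

Lemma actM A B F : act (A *m B) F = act A (act B F).
Proof.
apply/fsetP=> g; apply/idP/idP => [/actP[f Ff ->]|/actP[_ /actP[f Ff ->] ->]].
  by rewrite -mulmxA !mem_act.
by rewrite mulmxA mem_act.
Qed.

Lemma actK T F : T \in unitmx -> act (invmx T) (act T F) = F.
Proof. by move=> uT; rewrite -actM mulVmx ?act1. Qed.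

Lemma basis_span F v : is_basis F ->
  exists c : F -> int, v = \sum_(f : F) c f *: val f.
Proof. by case/(_ v)=> c [-> _]; exists c. Qed.

Lemma mulmx_comb (I : finType) T (c : I -> int) (b : I -> 'cV[int]_n) :
  T *m (\sum_i c i *: b i) = \sum_i c i *: (T *m b i).
Proof. by rewrite mulmx_sumr; apply: eq_bigr => i _; rewrite -scalemxAr. Qed.

Lemma eq_mx_basis F A B : is_basis F ->
  (forall f, f \in F -> A *m f = B *m f) -> A = B.
Proof.
move=> bF eqAB.
have eqv (v : 'cV[int]_n) : A *m v = B *m v.
  have [c ->] := basis_span v bF.
  by rewrite !mulmx_comb; apply: eq_bigr => f _; rewrite eqAB ?fsvalP.
apply/matrixP=> i j; have := eqv (delta_mx j 0).
by rewrite -!colE => /matrixP/(_ i 0); rewrite !mxE.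
Qed.

Lemma basis_act T F : T \in unitmx -> is_basis F -> is_basis (act T F).
Proof.
move=> uT bF v.
pose h (f : F) : act T F := [` mem_act T (fsvalP f)]%fset.
have inF (g : act T F) : invmx T *m val g \in F.
  by rewrite -[X in _ \in X](actK _ uT) mem_act ?fsvalP.
pose h' (g : act T F) : F := [` inF g]%fset.
have hK : cancel h h' by move=> f; apply: val_inj; rewrite /= mulKmx.
have h'K : cancel h' h by move=> g; apply: val_inj; rewrite /= mulKVmx.
have sumh (d : {ffun act T F -> int}) :
    \sum_g d g *: val g = T *m \sum_f d (h f) *: val f.
  by rewrite mulmx_comb (reindex h) //; apply: onW_bij; exists h'.
have [c [vc c_uniq]] := bF (invmx T *m v).
exists [ffun g => c (h' g)]; split.
  rewrite sumh -[LHS](mulKVmx uT) vc; congr (_ *m _).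
  by apply: eq_bigr => f _; rewrite ffunE hK.
move=> d vd; apply/ffunP=> g; rewrite ffunE.
rewrite (c_uniq [ffun f => d (h f)]) ?ffunE ?h'K //.
rewrite vd sumh mulKmx //.
by apply: eq_bigr => f _; rewrite ffunE.
Qed.

(** A matrix is determined by the images of the basis vectors, and here these
    lie in the finite set F. *)
Lemma finite_mx_onto E F : is_basis E -> finite_set [set T | act T E = F].
Proof.
move=> bE.
(* The values are optional so that r is total; they are all defined on the
   matrices mapping E onto F. *)
pose r (T : 'M[int]_n) : {ffun E -> option F} :=
  [ffun e : E => insub (T *m val e)].
pose g (d : {ffun E -> option F}) : 'M[int]_n :=
  xget 0 [set T | act T E = F /\ r T = d].
apply: (@sub_finite_set _ _ (g @` [set: {ffun E -> option F}])); last first.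
  exact/finite_image/finite_finset.
move=> T /= TE; exists (r T) => //; rewrite /g; case: xgetP => [U _ [UE rU]|].
  apply: (eq_mx_basis bE) => e Ee.
  have /ffunP/(_ [` Ee]%fset) := rU; rewrite !ffunE /=.
  have inU : U *m e \in F by rewrite -UE mem_act.
  have inT : T *m e \in F by rewrite -TE mem_act.
  by rewrite !insubT => -[].
by move/(_ T)=> /=; case.
Qed.

End Bases.

(** * The quadratic form of a bicharacter *)

Section Forms.
Variables (k : fieldType) (n : nat).
Implicit Types (chi : bicharacter k n) (x y z : 'cV[int]_n).

(** The polarization of the quadratic form chi x x, written multiplicatively;
    diagrams and reflections depend on chi only through this form. *)
Definition polar chi x y : k := chi x y * chi y x.

Lemma polarC chi x y : polar chi x y = polar chi y x.
Proof. exact: mulrC. Qed.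

Lemma polarDl chi x y z : polar chi (x + y) z = polar chi x z * polar chi y z.
Proof. by rewrite /polar bicharDl bicharDr mulrACA. Qed.

Lemma polar_neq0 chi x y : polar chi x y != 0.
Proof. by rewrite mulf_neq0 ?bichar_neq0. Qed.

Lemma polar0l chi y : polar chi 0 y = 1.
Proof. by rewrite /polar bichar0l bichar0r mulr1. Qed.

Lemma polarNl chi x y : polar chi (- x) y = (polar chi x y)^-1.
Proof.
apply: (mulIf (polar_neq0 chi x y)).
by rewrite -polarDl addNr polar0l mulVf ?polar_neq0.
Qed.

Lemma polarNr chi x y : polar chi x (- y) = (polar chi x y)^-1.
Proof. by rewrite polarC polarNl polarC. Qed.

Lemma bichar_normD chi x y :
  chi (x + y) (x + y) = chi x x * chi y y * polar chi x y.
Proof.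
rewrite bicharDl !bicharDr /polar [chi y x * _]mulrC -!mulrA; congr (_ * _).
by rewrite mulrCA.
Qed.

Lemma polarE chi x y :
  polar chi x y = chi (x + y) (x + y) / (chi x x * chi y y).
Proof. by rewrite bichar_normD mulrC mulKf // mulf_neq0 ?bichar_neq0. Qed.

Lemma bichar_normN chi x : chi (- x) (- x) = chi x x.
Proof.
apply: (mulIf (bichar_neq0 chi x x)); apply: (mulIf (polar_neq0 chi (-x) x)).
rewrite -bichar_normD addNr bichar0l polarNl /polar mulfV //.
by rewrite mulf_neq0 ?bichar_neq0.
Qed.

Definition pull_bichar (T : 'M[int]_n) chi : bicharacter k n.
Proof.
apply: (@Bicharacter k n (fun x y => chi (T *m x) (T *m y))) => *.
- exact: bichar_neq0.
- by rewrite mulmx0 bichar0l.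
- by rewrite mulmx0 bichar0r.
- by rewrite mulmxDr bicharDl.
- by rewrite mulmxDr bicharDr.
Defined.

Lemma eq_polar chi chi' (x y x' y' : 'cV[int]_n) :
  chi x x = chi' x' x' -> chi y y = chi' y' y' ->
  chi (x + y) (x + y) = chi' (x' + y') (x' + y') ->
  polar chi x y = polar chi' x' y'.
Proof. by move=> xx yy xy; rewrite !polarE xx yy xy. Qed.

Lemma eq_dynkin (I : eqType) chi chi' (b b' : I -> 'cV[int]_n) :
  (forall i, chi (b i) (b i) = chi' (b' i) (b' i)) ->
  (forall i j,
     chi (b i + b j) (b i + b j) = chi' (b' i + b' j) (b' i + b' j)) ->
  dynkin chi b = dynkin chi' b'.
Proof.
move=> eqv eqe; rewrite /dynkin; congr Diagram; first exact/funext.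
apply/funext=> i; apply/funext=> j; rewrite -/(polar chi _ _).
by rewrite -/(polar chi' _ _) (eq_polar (eqv i) (eqv j) (eqe i j)).
Qed.

(** The labels of a diagram are the values of the quadratic form and of its
    polarization on basis vectors, an absent edge standing for the value 1.
    The form at a combination is then reached by adding or subtracting one
    basis vector at a time. *)
Lemma dynkin_norm (I : finType) chi chi' (b b' : I -> 'cV[int]_n)
    (c : I -> int) : dynkin chi b = dynkin chi' b' ->
  let v := \sum_i c i *: b i in let v' := \sum_i c i *: b' i in
  chi v v = chi' v' v'.
Proof.
case=> eqv eqe v v'.
have vl i : chi (b i) (b i) = chi' (b' i) (b' i).
  by have := congr1 (@^~ i) eqv.
have pl i j : polar chi (b i) (b j) = polar chi' (b' i) (b' j).
  have [<-|ij] := eqVneq i j; first by rewrite /polar vl.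
  have := congr1 (fun g => g i j) eqe; rewrite /= ij /= -!/(polar _ _ _).
  by do 2![case: eqP => [->|_]] => // -[].
(* Agreement of the polarizations with every basis vector is what makes the
   agreement of the forms survive the addition of a basis vector. *)
pose P x x' := chi x x = chi' x' x' /\
  forall i, polar chi x (b i) = polar chi' x' (b' i).
have PD x x' i : P x x' -> P (x + b i) (x' + b' i).
  case=> qx px; split=> [|j]; last by rewrite !polarDl px pl.
  by rewrite !bichar_normD qx vl px.
have PB x x' i : P x x' -> P (x - b i) (x' - b' i).
  case=> qx px; split=> [|j]; last by rewrite !polarDl !polarNl px pl.
  by rewrite !bichar_normD !bichar_normN !polarNr qx vl px.
have PZ x x' i (m : int) : P x x' -> P (x + m *: b i) (x' + m *: b' i).
  move=> Px; elim: m => [|m IH|m IH]; first by rewrite !scale0r !addr0.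
    by rewrite intS ![1 + _]addrC !scalerDl !scale1r !addrA; apply: PD.
  by rewrite intS opprD ![-1 + _]addrC !scalerDl !scaleN1r !addrA; apply: PB.
suff [] : P v v' by [].
rewrite {}/v {}/v'.
elim: (index_enum I) => [|i r IH].
  by rewrite !big_nil; split=> [|i]; rewrite ?bichar0l ?polar0l.
by rewrite !big_cons ![_ *: _ + _]addrC; apply: PZ.
Qed.

End Forms.

(** * Reflections *)

Section Reflections.
Variables (k : fieldType) (n : nat).
Implicit Types (chi : bicharacter k n) (F : {fset 'cV[int]_n}).
Implicit Types (f g : 'cV[int]_n) (s T : 'M[int]_n) (m : int).

(** The condition defining m(f, f') involves only q = chi f f and the
    polarization r of f and f'. *)
Definition cartan_test (q r : k) (p : nat) : Prop :=
  q ^+ p * r = 1 \/ (q ^+ p.+1 = 1 /\ q <> 1).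

Definition least_test (q r : k) (p : nat) : Prop :=
  cartan_test q r p /\ forall p', cartan_test q r p' -> (p <= p')%N.

Lemma cartan_entryE chi f g m : cartan_entry chi f g m <->
  if g == f then m = - 2%:Z
  else exists2 p : nat, m = p%:Z & least_test (chi f f) (polar chi f g) p.
Proof.
rewrite /cartan_entry; case: eqP => // _.
have eqC p : cartan_cond chi f g p = cartan_test (chi f f) (polar chi f g) p.
  by rewrite /cartan_cond /cartan_test /polar mulrA.
split=> [[p [-> Cp min_p]]|[p -> [Cp min_p]]]; exists p => //.
  by split=> [|p']; rewrite -eqC //; apply: min_p.
by split=> [||p'] //; rewrite eqC //; apply: min_p.
Qed.

Lemma cartan_entry_inj chi f g m1 m2 :
  cartan_entry chi f g m1 -> cartan_entry chi f g m2 -> m1 = m2.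
Proof.
rewrite !cartan_entryE; case: eqP => [_ -> -> //|_].
case=> p -> [Cp min_p] [p' -> [Cp' min_p']]; congr Posz.
by apply/eqP; rewrite eqn_leq min_p ?min_p'.
Qed.

Lemma reflection_inj chi F f s1 s2 : is_basis F ->
  reflection chi F f s1 -> reflection chi F f s2 -> s1 = s2.
Proof.
move=> bF [_ ref1] [_ ref2]; apply: (eq_mx_basis bF) => g Fg.
have [m1 [C1 ->]] := ref1 g Fg; have [m2 [C2 ->]] := ref2 g Fg.
by rewrite (cartan_entry_inj C1 C2).
Qed.

(** With T = 1 this says that bicharacters with the same quadratic form have
    the same reflections; with both bicharacters equal, that an isometry
    conjugates reflections into reflections. *)
Lemma reflection_isometry chi chi' T F f s : T \in unitmx ->
  (forall v, chi v v = chi' (T *m v) (T *m v)) ->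
  reflection chi F f s ->
  reflection chi' (act T F) (T *m f) (T *m s *m invmx T).
Proof.
move=> uT iso [Ff ref]; split; first exact: mem_act.
move=> _ /actP[g Fg ->]; have [m [Cm sg]] := ref g Fg; exists m; split.
  move: Cm; rewrite !cartan_entryE (can_eq (mulKmx uT)) -iso.
  by rewrite (@eq_polar _ _ chi chi' _ _ (T *m f) (T *m g)) -?mulmxDr.
by rewrite -!mulmxA mulKmx // sg mulmxDr -scalemxAr.
Qed.

Lemma reflection_self chi F f s : reflection chi F f s -> s *m f = - f.
Proof.
case=> Ff /(_ f Ff)[m []]; rewrite cartan_entryE eqxx => -> ->.
by rewrite scaleNr (intS 1) scalerDl !scale1r opprD addNKr.
Qed.

Lemma reflectionK chi F f s : is_basis F -> reflection chi F f s ->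
  s *m s = 1%:M.
Proof.
move=> bF ref; apply: (eq_mx_basis bF) => g Fg; rewrite mul1mx -mulmxA.
have [m [_ sg]] := ref.2 g Fg.
by rewrite sg mulmxDr -scalemxAr (reflection_self ref) sg scalerN addrK.
Qed.

Lemma reflection_unit chi F f s : is_basis F -> reflection chi F f s ->
  s \in unitmx.
Proof. by move=> bF /(reflectionK bF)/mulmx1_unit[]. Qed.

(** Reflecting replaces r by the inverse of r q^(2p), where p = m(f, f'). The
    exponent p passes the new test because q^p r = 1 makes the new r equal to
    q^-p, and otherwise because its second clause does not involve r. A smaller
    exponent p' passing the new test gives q^p' = r q^(2p), and then
    an exponent below p passes the old one: p' itself if q^p r = 1, and
    p - p' - 1 if q^(p + 1) = 1. *)
Lemma least_test_reflect (q r : k) p : q != 0 ->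
  least_test q r p -> least_test q ((r * q ^+ p * q ^+ p)^-1) p.
Proof.
move=> q0 [Cp min_p].
have qX0 i : q ^+ i != 0 by rewrite expf_neq0.
have r0 : q ^+ p * r = 1 -> r != 0.
  by move=> qr; apply/eqP=> r0; move/eqP: qr; rewrite r0 mulr0 eq_sym oner_eq0.
split.
  case: Cp => [qr|[qp q1]]; last by right.
  by left; rewrite [r * _]mulrC qr mul1r mulfV.
move=> p' [|tail]; last by apply: min_p; right.
set z := r * _ * _ => qz.
have z0 : z != 0.
  by apply: contra_eq_neq qz => ->; rewrite invr0 mulr0 eq_sym oner_neq0.
have {}qz : q ^+ p' = r * q ^+ p * q ^+ p.
  by rewrite -[LHS](mulfVK z0) qz mul1r.
rewrite leqNgt; apply/negP=> lt_p'p.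
case: Cp => [qr|[qp q1]].
  suff /min_p : cartan_test q r p' by rewrite leqNgt lt_p'p.
  by left; rewrite qz [r * _]mulrC qr mul1r.
suff /min_p : cartan_test q r (p - p'.+1)%N.
  by rewrite leqNgt ltn_subrL (leq_trans _ lt_p'p).
left; apply: (mulIf (qX0 p'.+2)); rewrite mul1r mulrAC -exprD.
have -> : q ^+ p'.+2 = r * (q ^+ p.+1 * q ^+ p.+1).
  by rewrite !exprSr qz mulrACA !mulrA.
by rewrite addnS subnK // qp !mulr1 mul1r.
Qed.

(** The Cartan entries do not change under reflection, so that s, being an
    involution, is its own way back. *)
Lemma reflection_back chi F f s : is_basis F -> reflection chi F f s ->
  reflection chi (act s F) (- f) s.
Proof.
move=> bF ref; have uS := reflection_unit bF ref.
have sf := reflection_self ref.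
have sK g : s *m (s *m g) = g by rewrite mulmxA (reflectionK bF ref) mul1mx.
split; first by rewrite -sf mem_act //; case: ref.
move=> _ /actP[g Fg ->]; have [m [Cm sg]] := ref.2 g Fg; exists m; split.
  move: Cm; rewrite !cartan_entryE -sf (can_eq sK) sf.
  case: eqP => // _ [p m_p least_p]; exists p => //.
  rewrite bichar_normN sg m_p polarNl polarC polarDl.
  have -> : polar chi (p%:Z *: f) f = chi f f ^+ p * chi f f ^+ p.
    rewrite -exprD addnn; elim: p {least_p m_p} => [|p IH].
      by rewrite scale0r polar0l.
    by rewrite intS scalerDl scale1r polarDl IH doubleS !exprS mulrA.
  rewrite mulrA [polar chi g f]polarC.
  by apply: least_test_reflect => //; apply: bichar_neq0.
by rewrite sK sg scalerN addrK.
Qed.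

End Reflections.

(** * The Weyl groupoid *)

Section Groupoid.
Variables (k : fieldType) (n : nat).
Implicit Types (chi : bicharacter k n) (E F : {fset 'cV[int]_n}).
Implicit Types (T U s : 'M[int]_n).

Lemma full_groupoid_closed chi :
  subgroupoid (@full_groupoid n) /\ reflection_closed chi (@full_groupoid n).
Proof.
split; [split=> [//|T1 F1 T2 F2|T F] | move=> F f s].
- by case=> uT1 _ [uT2 bF2] _; split; rewrite //= unitmx_mul uT1.
- by case=> uT bF; split; rewrite /= ?unitmx_inv //; apply: basis_act.
case=> _ bF ref; have uS := reflection_unit bF ref.
by do !split; rewrite /= ?unitmx1 //; apply: basis_act.
Qed.

Lemma weyl_full chi E : is_basis E ->
  weyl_groupoid chi E `<=` @full_groupoid n.
Proof.
move=> bE; apply: smallest_sub; first exact: full_groupoid_closed.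
by move=> _ ->; split; rewrite /= ?unitmx1.
Qed.

Lemma weyl_id chi E : weyl_groupoid chi E (1%:M, E).
Proof. by move=> S [_ SE]; apply: SE. Qed.

Lemma weyl_comp chi E T1 T2 F :
  weyl_groupoid chi E (T1, act T2 F) -> weyl_groupoid chi E (T2, F) ->
  weyl_groupoid chi E (T1 *m T2, F).
Proof.
move=> W1 W2 S SE; have [[[_ SM _] _] _] := SE.
exact: (SM _ _ _ _ (W1 S SE) (W2 S SE) erefl).
Qed.

Lemma weyl_inv chi E T F : weyl_groupoid chi E (T, F) ->
  weyl_groupoid chi E (invmx T, act T F).
Proof.
by move=> W1 S SE; have [[[_ _ SV] _] _] := SE; exact: (SV _ _ (W1 S SE)).
Qed.

Lemma weyl_reflection chi E F f s : weyl_groupoid chi E (1%:M, F) ->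
  reflection chi F f s -> weyl_groupoid chi E (s, F).
Proof.
move=> W1 ref S SE; have [[_ SR] _] := SE.
exact: (proj1 (SR _ _ _ (W1 S SE) ref)).
Qed.

Lemma weyl_src chi E T F : is_basis E -> weyl_groupoid chi E (T, F) ->
  weyl_groupoid chi E (1%:M, F).
Proof.
move=> bE WT; have [uT _] := weyl_full bE WT.
by rewrite -(mulVmx uT); exact: (weyl_comp (weyl_inv WT) WT).
Qed.

Lemma weyl_tgt chi E T F : is_basis E -> weyl_groupoid chi E (T, F) ->
  weyl_groupoid chi E (1%:M, act T F).
Proof. by move=> bE /weyl_inv/(weyl_src bE). Qed.

(** Closure under reflections also asks for the identity of the reflected
    basis, but this identity is a composite of s and its inverse; it therefore
    gives no induction case. *)
Lemma weyl_ind chi E (P : 'M[int]_n -> {fset 'cV[int]_n} -> Prop) :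
  is_basis E -> P 1%:M E ->
  (forall T1 T2 F, weyl_groupoid chi E (T1, act T2 F) ->
     weyl_groupoid chi E (T2, F) -> P T1 (act T2 F) -> P T2 F ->
     P (T1 *m T2) F) ->
  (forall T F, weyl_groupoid chi E (T, F) -> P T F ->
     P (invmx T) (act T F)) ->
  (forall F f s, weyl_groupoid chi E (1%:M, F) -> reflection chi F f s ->
     P 1%:M F -> P s F) ->
  forall T F, weyl_groupoid chi E (T, F) -> P T F.
Proof.
move=> bE P1 PM PV PR T F WTF.
suff [] : (weyl_groupoid chi E `&` [set p | P p.1 p.2]) (T, F) by [].
have Wfull := @weyl_full chi E bE.
apply: WTF; split; last by move=> _ ->; split; first exact: weyl_id.
split=> [|G f s [/= WG PG] ref].
  split=> [p [/Wfull]//|T1 F1 T2 F2 [/= W1 PT1] [/= W2 PT2] F12|U G].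
    by subst F1; split; [exact: (weyl_comp W1 W2)|apply: PM].
  by case=> /= WU PU; split; [exact: (weyl_inv WU)|apply: PV].
have Ws := weyl_reflection WG ref; have Ps := PR _ _ _ WG ref PG.
have [us _] := Wfull _ Ws; do !split=> //=; first exact: weyl_tgt Ws.
have := PM s (invmx s) (act s G); rewrite actK // mulmxV //; apply=> //.
  exact: (weyl_inv Ws).
exact: PV.
Qed.

Lemma weyl_sub chi E F : is_basis E -> weyl_groupoid chi E (1%:M, F) ->
  weyl_groupoid chi F `<=` weyl_groupoid chi E.
Proof.
move=> bE WF [T G]; have [_ bF] := weyl_full bE WF.
move: T G; apply: (weyl_ind (P := fun T G => weyl_groupoid chi E (T, G)))
  => // [T1 T2 H _ _ W1 W2|U H _ WU|H f s _ ref WH].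
- exact: (weyl_comp W1 W2).
- exact: (weyl_inv WU).
- exact: (weyl_reflection WH ref).
Qed.

(** The only closure property in which the base matters is reachability of the
    base itself, and reflections can be undone by reflections. *)
Lemma weyl_base chi E T F : is_basis E -> weyl_groupoid chi E (T, F) ->
  weyl_groupoid chi F = weyl_groupoid chi E.
Proof.
move=> bE WTF; have : weyl_groupoid chi F = weyl_groupoid chi E /\
                 weyl_groupoid chi (act T F) = weyl_groupoid chi E.
  move: T F WTF; apply: (weyl_ind (P := fun T F =>
    weyl_groupoid chi F = weyl_groupoid chi E /\
    weyl_groupoid chi (act T F) = weyl_groupoid chi E)) => //.
  - by rewrite act1.
  - by move=> T1 T2 F _ _ [_ T1F] [F2 _]; rewrite actM.
  - by move=> T F WTF [WF WT]; rewrite actK //; case: (weyl_full bE WTF).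
  move=> F f s WF ref [eqF _]; split=> //; rewrite -eqF.
  have [/= _ bF] := weyl_full bE WF.
  have us := reflection_unit bF ref.
  have bsF := basis_act us bF.
  apply/seteqP; split; apply: weyl_sub => //.
    exact: (weyl_tgt bF (weyl_reflection (@weyl_id chi F) ref)).
  have ref' := reflection_back bF ref.
  have := weyl_tgt bsF (weyl_reflection (@weyl_id chi _) ref').
  by rewrite -actM (reflectionK bF ref) act1.
by case.
Qed.

(** Conjugation by T carries the reflections used to generate the groupoid of
    E to reflections, since those depend only on the form that T preserves. *)
Lemma weyl_conj chi E T U F : is_basis E -> T \in unitmx ->
  (forall v, chi v v = chi (T *m v) (T *m v)) ->
  weyl_groupoid chi E (U, F) ->
  weyl_groupoid chi (act T E) (T *m U *m invmx T, act T F).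
Proof.
move=> bE uT iso; move: U F; apply: (weyl_ind (P := fun U F =>
  weyl_groupoid chi (act T E) (T *m U *m invmx T, act T F))) => //.
- by rewrite mulmx1 mulmxV //; apply: weyl_id.
- move=> U1 U2 F _ _ W1 W2.
  have -> : T *m (U1 *m U2) *m invmx T =
            (T *m U1 *m invmx T) *m (T *m U2 *m invmx T).
    by rewrite !mulmxA mulmxKV.
  by apply: (weyl_comp _ W2); rewrite -!actM mulmxKV // actM.
- move=> U F WU /weyl_inv; have [uU _] := weyl_full bE WU.
  have uA : T *m U *m invmx T \in unitmx.
    by rewrite !unitmx_mul uT unitmx_inv uT andbT.
  have AB : (T *m U *m invmx T) *m (T *m invmx U *m invmx T) = 1%:M.
    by rewrite !mulmxA mulmxKV // mulmxK // mulmxV.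
  rewrite -[T *m invmx U *m _](mulKmx uA) AB mulmx1.
  by rewrite -!actM mulmxKV // actM.
- move=> F f s _ ref; rewrite mulmx1 mulmxV // => W1.
  exact: (weyl_reflection W1 (reflection_isometry uT iso ref)).
Qed.

(** With T = T1 T2^-1, the steps E -> T1(E) -> T(E) given by T1 and by
    the conjugate T T2^-1 T^-1 of the inverse of T2 compose to T. *)
Lemma weyl_isometry chi E T1 T2 : is_basis E ->
  weyl_groupoid chi E (T1, E) -> weyl_groupoid chi E (T2, E) ->
  (forall v, chi (T1 *m v) (T1 *m v) = chi (T2 *m v) (T2 *m v)) ->
  weyl_groupoid chi E (T1 *m invmx T2, E).
Proof.
move=> bE W1 W2 iso; have [uT1 _] := weyl_full bE W1.
have [uT2 _] := weyl_full bE W2.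
set T := T1 *m invmx T2.
have uT : T \in unitmx by rewrite unitmx_mul uT1 unitmx_inv.
have TT2 : act T (act T2 E) = act T1 E by rewrite -actM mulmxKV.
have isoT v : chi v v = chi (T *m v) (T *m v).
  by rewrite -[v](mulKVmx uT2) -iso -!mulmxA mulKmx.
have WT1 := weyl_base bE (weyl_tgt bE W1).
have WT2 := weyl_base bE (weyl_tgt bE W2).
have [_ bT2] := weyl_full bE (weyl_tgt bE W2).
have conjT U F : weyl_groupoid chi E (U, F) ->
    weyl_groupoid chi E (T *m U *m invmx T, act T F).
  by rewrite -{1}WT2 => /(weyl_conj bT2 uT isoT); rewrite TT2 WT1.
have := conjT _ _ (weyl_inv W2); rewrite TT2 => /weyl_comp/(_ W1).
rewrite -!mulmxA [invmx T *m _](_ : _ = T2) ?mulVmx ?mulmx1 //.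
by apply: (can_inj (mulKmx uT)); rewrite mulKVmx // mulmxKV.
Qed.

(** Reflections only lead to bases T1(E) with (T1, E) in the groupoid, and
    every morphism between such bases lifts to a morphism starting at E. *)
Lemma weyl_span chi E U F : is_basis E -> weyl_groupoid chi E (U, F) ->
  exists T1 T2, [/\ weyl_groupoid chi E (T1, E), weyl_groupoid chi E (T2, E)
    & (U, F) = (T2 *m invmx T1, act T1 E)].
Proof.
move=> bE WUF.
suff [T WT FT] : exists2 T, weyl_groupoid chi E (T, E) & F = act T E.
  have [uT _] := weyl_full bE WT; subst F.
  exists T, (U *m T); split=> //; first by apply: (weyl_comp WUF).
  by rewrite mulmxK.
move: U F WUF; apply: (weyl_ind (P := fun _ F =>
  exists2 T, weyl_groupoid chi E (T, E) & F = act T E)) => //.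
  by exists 1%:M; [apply: weyl_id|rewrite act1].
move=> U F WU [T WT FT]; exists (U *m T); last by rewrite actM FT.
by rewrite FT in WU; exact: (weyl_comp WU WT).
Qed.

Lemma weyl_sub_ext chi E :
  weyl_groupoid chi E `<=` weyl_groupoid_ext chi E.
Proof.
by move=> [T F] WT; exists T, 1%:M, F; rewrite !mul1mx unitmx1.
Qed.

Lemma weyl_ext_target chi E T F : weyl_groupoid_ext chi E (T, F) ->
  exists2 U, weyl_groupoid chi E (U, F) & act T F = act U F.
Proof. by case=> [U [tau [G [WU _ eqF [-> ->]]]]]; exists U. Qed.

End Groupoid.

(** * Finiteness *)

Section Finiteness.
Variables (k : fieldType) (n : nat) (chi : bicharacter k n).
Variables (E : {fset 'cV[int]_n}) (E_basis : is_basis E).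
Implicit Types (T : 'M[int]_n).

Definition dynkin_along (chi0 : bicharacter k n) T : diagram k E :=
  dynkin chi0 (fun e : E => T *m val e).

Lemma dynkin_pull (chi1 chi2 : bicharacter k n) T :
  (forall v, chi1 v v = chi2 (T *m v) (T *m v)) ->
  dynkin chi1 (fun e : E => val e) = dynkin_along chi2 T.
Proof. by move=> iso; apply: eq_dynkin => [e|e e']; rewrite iso ?mulmxDr. Qed.

Lemma dynkin_isometry chi1 chi2 T1 T2 :
  dynkin_along chi1 T1 = dynkin_along chi2 T2 ->
  forall v, chi1 (T1 *m v) (T1 *m v) = chi2 (T2 *m v) (T2 *m v).
Proof.
move=> eqD v; have [c ->] := basis_span v E_basis.
by rewrite !mulmx_comb; apply: (dynkin_norm c eqD).
Qed.

Lemma finite_weyl : finite_set [set T | weyl_groupoid chi E (T, E)] ->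
  finite_set (weyl_groupoid chi E).
Proof.
move=> finR; apply: sub_finite_set (finite_image2
  (fun T1 T2 => (T2 *m invmx T1, act T1 E)) finR finR).
move=> [U F] /(weyl_span E_basis)[T1 [T2 [W1 W2 ->]]].
by exists T1 => //; exists T2.
Qed.

Lemma finite_weyl_ext : finite_set (weyl_groupoid chi E) ->
  finite_set [set T | weyl_groupoid_ext chi E (T, E)].
Proof.
move=> finW; apply: (@sub_finite_set _ _ (\bigcup_(p in weyl_groupoid chi E)
   [set T | act T E = act p.1 p.2])).
  by move=> T /= /weyl_ext_target[U WU eqTU]; exists (U, E).
by apply: bigcup_finite => // p _; apply: finite_mx_onto.
Qed.

(** An arrow is recovered from its source and its label: the source determines
    the quadratic form on all of Z^n, the form determines the reflection, and
    both determine the target. *)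
Lemma finite_weyl_graph : finite_set [set T | weyl_groupoid_ext chi E (T, E)] ->
  finite_digraph (weyl_graph chi E).
Proof.
move=> finX.
have finV : finite_set (gvertices (weyl_graph chi E)).
  apply: sub_finite_set (finite_image (dynkin_along chi) finX).
  move=> _ [chi' [[T [_ XT iso]] ->]]; exists T => //.
  by rewrite (dynkin_pull iso).
split=> //; set A := garrows _.
pose tgt (p : diagram k E * E) :=
  if pselect (exists D, A (p.1, p.2, D)) is left ex then projT1 (cid ex)
  else p.1.
have finVE := finite_setX finV (@finite_finset E [set: E]).
apply: sub_finite_set (finite_image (fun p => (p.1, p.2, tgt p)) finVE).
move=> a Aa; have [chi1 [e [s1 [eq1 ref1 a_eq]]]] := Aa.
subst a; set D := dynkin chi1 _ in Aa *; set D1 := dynkin _ _ in Aa *.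
exists (D, e); first by split=> //=; exists chi1.
congr (_, _, _); rewrite /tgt /=; case: pselect => [ex|[]]; last by exists D1.
case: (cid ex) => D2 /=; case => chi2 [e2 [s2 [_ ref2 eqA]]].
have DD := congr1 (fun a => a.1.1) eqA.
have /= ee := congr1 (fun a => a.1.2) eqA; subst e2.
have /= -> := congr1 snd eqA; rewrite {eqA} /= in DD.
have iso v : chi1 v v = chi2 v v.
  have dyn1 (chi' : bicharacter k n) : dynkin chi' (fun e : E => val e) =
      dynkin_along chi' 1%:M.
    by apply: dynkin_pull => w; rewrite mul1mx.
  move: DD; rewrite /D !dyn1 => /dynkin_isometry/(_ v).
  by rewrite !mul1mx.
have {ref1} := reflection_isometry (unitmx1 _ _) _ ref1.
move=> /(_ chi2); rewrite act1 !mul1mx invmx1 mulmx1 => ref1.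
rewrite /D1 (reflection_inj E_basis (ref1 _) ref2) => [|w].
  by apply: eq_dynkin => *; rewrite iso.
by rewrite !mul1mx.
Qed.

(** The set of T with a given diagram is, up to translation by T0, a set of
    isometries in the groupoid. *)
Lemma finite_isometric T0 : weyl_groupoid chi E (T0, E) ->
  finite_set (weyl_aut_group chi E) ->
  finite_set [set T | weyl_groupoid chi E (T, E) /\
    dynkin_along chi T = dynkin_along chi T0].
Proof.
move=> W0 finG; apply: sub_finite_set (finite_image (mulmxr T0) finG).
have [uT0 _] := weyl_full E_basis W0.
move=> T [WT /dynkin_isometry iso]; exists (T *m invmx T0); last first.
  by rewrite /= mulmxKV.
have WTT0 := weyl_isometry E_basis WT W0 iso.
have [uTT0 _] := weyl_full E_basis WTT0.
split=> // [|v]; first exact: weyl_sub_ext.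
by rewrite -!mulmxA iso mulKVmx.
Qed.

Lemma finite_weyl_hom : finite_set (gvertices (weyl_graph chi E)) ->
  finite_set (weyl_aut_group chi E) ->
  finite_set [set T | weyl_groupoid chi E (T, E)].
Proof.
move=> finV finG.
apply: (@sub_finite_set _ _ (\bigcup_(D in gvertices (weyl_graph chi E))
   [set T | weyl_groupoid chi E (T, E) /\ dynkin_along chi T = D])).
  move=> T /= WT; exists (dynkin_along chi T) => //; exists (pull_bichar T chi).
  split; last by rewrite (@dynkin_pull _ chi T).
  have [uT _] := weyl_full E_basis WT.
  by exists T; split=> //; apply: weyl_sub_ext.
apply: bigcup_finite => // D _.
have [[T0 [W0 <-]]|noT] :=
  pselect (exists T, weyl_groupoid chi E (T, E) /\ dynkin_along chi T = D).
  exact: finite_isometric.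
apply: (@sub_finite_set _ _ set0); last exact: finite_set0.
by move=> T WT; case: noT; exists T.
Qed.

End Finiteness.

Theorem lemma6 (k : fieldType) (k_char0 : [pchar k]%R =i pred0) (n : nat)
    (chi : bicharacter k n) (E : {fset 'cV[int]_n}) (E_basis : is_basis E) :
  finite_set (weyl_groupoid chi E) <->
  finite_digraph (weyl_graph chi E) /\ finite_set (weyl_aut_group chi E).
Proof.
split=> [finW|[[finV _] finG]]; last exact/finite_weyl/finite_weyl_hom.
have finX := finite_weyl_ext E_basis finW.
split; first exact: finite_weyl_graph.
by apply: sub_finite_set finX => T [].
Qed.
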